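(* Let $\mathcal{H}=\bigotimes_{k=1}^{N}\mathbb{C}^{d_{k}}$ with $N\ge 3$ and $d_k\ge 2$ for all $k$. If $\mathcal{H}$ contains more than one maximal SLOCC equivalence class, then there does not exist a state $|\Phi\rangle\in\mathcal{H}$ that is universal for local state discrimination in $\mathcal{H}$, nor one that is universal for local unambiguous discrimination in $\mathcal{H}$. Moreover, there exist orthonormal bases $\mathcal{B}$ of $\mathcal{H}$ for which the set $|\Phi\rangle\otimes\mathcal{B}=\{|\Phi\rangle\otimes|\psi\rangle:|\psi\rangle\in\mathcal{B}\}$ is not perfectly distinguishable by LOCC for any $|\Phi\rangle\in\mathcal{H}$.
   Context: For $\mathcal{H}'=\bigotimes_{k=1}^N\mathbb{C}^{d'_k}$ (here $\mathcal{H}'=\mathcal{H}$), $\mathcal{H}'\otimes\mathcal{H}$ is regarded as an $N$-partite system with $k$-th local subsystem $\mathbb{C}^{d'_k}\otimes\mathbb{C}^{d_k}$, and LOCC is with respect to this split. A state $|\Phi\rangle\in\mathcal{H}'$ is universal for local state discrimination in $\mathcal{H}$ if for every set $\{|\psi_i\rangle\}$ of mutually orthogonal states in $\mathcal{H}$, the set $\{|\Phi\rangle\otimes|\psi_i\rangle\}$ can be perfectly distinguished by LOCC; it is universal for local unambiguous discrimination in $\mathcal{H}$ if for every set $\{|\psi_i\rangle\}_{i=1}^n$ of linearly independent states in $\mathcal{H}$, $\{|\Phi\rangle\otimes|\psi_i\rangle\}$ can be unambiguously distinguished by LOCC, i.e. there is an LOCC POVM $\{\Pi_i\}_{i=1}^{n+1}$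 with $\langle\Phi\otimes\psi_j|\Pi_i|\Phi\otimes\psi_j\rangle=\delta_{ij}\epsilon_i$, $\epsilon_i>0$, for $i,j\le n$. Two pure states of $\mathcal{H}$ are in the same SLOCC class if each can be transformed into the other by LOCC (among the $N$ parties) with positive probability. A class $\mathcal{C}$ is maximal if for all $|\phi\rangle\in\mathcal{C}$ and $|\psi\rangle\in\mathcal{H}$, the existence of an LOCC transformation $|\psi\rangle\to|\phi\rangle$ with positive probability implies $|\psi\rangle\in\mathcal{C}$. *)

(* Defs.v *)
From HB Require Import structures.
From mathcomp Require Import all_boot all_order all_algebra.
From mathcomp Require Import reals complex.
Set Implicit Arguments. Unset Strict Implicit. Unset Printing Implicit Defensive.
Import Order.TTheory GRing.Theory Num.Theory.
Local Open Scope ring_scope.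

(* An N-partite system: party k has a finite set of local basis labels L k,
   i.e. local Hilbert space C^(L k).  A global basis label is a dependent
   finite function f : forall k, L k; vectors of the global (tensor product)
   space are functions from global labels to C, operators are kernels. *)
Definition glab (N : nat) (L : 'I_N -> finType) := {dffun forall k : 'I_N, L k}.

Definition vec (C : numClosedFieldType) N (L : 'I_N -> finType) := glab L -> C.
Definition op (C : numClosedFieldType) N (L : 'I_N -> finType) := glab L -> glab L -> C.

Section Quantum.
Context (C : numClosedFieldType) (N : nat) (L : 'I_N -> finType).

Definition dotv (u v : vec C L) : C := \sum_f (u f)^* * v f.
Definition is_state (v : vec C L) : Prop := dotv v v = 1.

Definition opv (M : op C L) (v : vec C L) : vec C L := fun f => \sum_g M f g * v g.
Definition opm (M P : op C L) : op C L := fun f g => \sum_h M f h * P h g.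
Definition adj (M : op C L) : op C L := fun f g => (M g f)^*.
Definition idop : op C L := fun f g => (f == g)%:R.
Definition zeroop : op C L := fun _ _ => 0.
Definition addop (M P : op C L) : op C L := fun f g => M f g + P f g.
Definition sumop (m : nat) (M : 'I_m -> op C L) : op C L :=
  fun f g => \sum_(j < m) M j f g.
Definition proj (v : vec C L) : op C L := fun f g => v f * (v g)^*.
Definition expect (M : op C L) (v : vec C L) : C := dotv v (opv M v).

Definition loc (k : 'I_N) (A : L k -> L k -> C) : op C L :=
  fun f g => (\prod_(j < N | j != k) (f j == g j)%:R) * A (f k) (g k).

(* Finite-round LOCC protocols with outcome set O: at every node one party k
   (chosen depending on all previous, broadcast, outcomes) performs a local
   instrument with finitely many (fine-grained) Kraus operators K j; the
   outcome j is broadcast and the protocol continues with subtree ch j.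
   Leaves carry the final classical output. *)
Inductive locc_tree (O : Type) : Type :=
| LLeaf : O -> locc_tree O
| LNode : forall (k : 'I_N) (m : nat), ('I_m -> L k -> L k -> C) ->
          ('I_m -> locc_tree O) -> locc_tree O.

Fixpoint locc_valid (O : Type) (t : locc_tree O) : Prop :=
  match t with
  | LLeaf _ => True
  | LNode k m K ch =>
      (forall a b : L k, \sum_(j < m) \sum_(c : L k) (K j c a)^* * K j c b
                          = (a == b)%:R)
      /\ (forall j, locc_valid (ch j))
  end.

(* POVM element of output o implemented by the protocol:
   sum over leaves with output o of M^dag M, M = product of Kraus ops on path *)
Fixpoint locc_povm (O : eqType) (t : locc_tree O) (o : O) : op C L :=
  match t with
  | LLeaf o' => if o' == o then idop else zeroop
  | LNode k m K ch =>
      sumop (fun j => opm (adj (loc (K j))) (opm (locc_povm (ch j) o) (loc (K j))))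
  end.

Fixpoint locc_post (O : eqType) (t : locc_tree O) (o : O) (rho : op C L) : op C L :=
  match t with
  | LLeaf o' => if o' == o then rho else zeroop
  | LNode k m K ch =>
      sumop (fun j => locc_post (ch j) o
                        (opm (loc (K j)) (opm rho (adj (loc (K j))))))
  end.

Definition is_locc_povm (n : nat) (Pi : 'I_n -> op C L) : Prop :=
  exists t : locc_tree 'I_n, locc_valid t /\ forall i, Pi i = locc_povm t i.

Definition locc_distinguishable (n : nat) (v : 'I_n -> vec C L) : Prop :=
  exists Pi : 'I_n -> op C L, is_locc_povm Pi /\
    forall i j, expect (Pi i) (v j) = (i == j)%:R.

Definition locc_unamb_distinguishable (n : nat) (v : 'I_n -> vec C L) : Prop :=
  exists (Pi : 'I_n.+1 -> op C L) (eps : 'I_n -> C), is_locc_povm Pi /\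
    (forall i, 0 < eps i) /\
    forall i j : 'I_n, expect (Pi (widen_ord (leqnSn n) i)) (v j)
                       = if i == j then eps i else 0.

Definition mutually_orthogonal_states (n : nat) (v : 'I_n -> vec C L) : Prop :=
  (forall i, is_state (v i)) /\ (forall i j, i != j -> dotv (v i) (v j) = 0).

Definition lin_indep_states (n : nat) (v : 'I_n -> vec C L) : Prop :=
  (forall i, is_state (v i)) /\
  (forall c : 'I_n -> C, (forall f, \sum_i c i * v i f = 0) -> forall i, c i = 0).

Definition orthonormal_basis (n : nat) (B : 'I_n -> vec C L) : Prop :=
  mutually_orthogonal_states B /\
  (forall v : vec C L, exists c : 'I_n -> C, forall f, v f = \sum_i c i * B i f).

(* psi -> phi by LOCC with positive probability: some output of some LOCC
   protocol occurs with positive probability p and leaves the state phi *)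
Definition slocc_trans (psi phi : vec C L) : Prop :=
  exists t : locc_tree bool, locc_valid t /\
    exists p : C, 0 < p /\
      locc_post t true (proj psi) = (fun f g => p * proj phi f g).

Definition slocc_equiv (psi phi : vec C L) : Prop :=
  slocc_trans psi phi /\ slocc_trans phi psi.

Definition maximal_class_of (phi : vec C L) : Prop :=
  forall phi' psi, is_state phi' -> is_state psi ->
    slocc_equiv phi phi' -> slocc_trans psi phi' -> slocc_equiv psi phi.

Definition more_than_one_maximal_class : Prop :=
  exists phi1 phi2, is_state phi1 /\ is_state phi2 /\
    maximal_class_of phi1 /\ maximal_class_of phi2 /\ ~ slocc_equiv phi1 phi2.

End Quantum.

Definition Hlab (N : nat) (d : 'I_N -> nat) : 'I_N -> finType :=
  fun k => ('I_(d k) : finType).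

(* H' (x) H regarded as N-partite with k-th local system C^(d'_k) (x) C^(d_k) *)
Definition pairlab (N : nat) (L' L : 'I_N -> finType) : 'I_N -> finType :=
  fun k => (L' k * L k)%type : finType.

Definition tens (C : numClosedFieldType) (N : nat) (L' L : 'I_N -> finType)
  (Phi : vec C L') (psi : vec C L) : vec C (pairlab L' L) :=
  fun f => Phi (finfun (fun k => (f k).1) : glab L')
           * psi (finfun (fun k => (f k).2) : glab L).

Definition universal_local_discr (C : numClosedFieldType) (N : nat)
  (L' L : 'I_N -> finType) (Phi : vec C L') : Prop :=
  forall (n : nat) (psi : 'I_n -> vec C L), mutually_orthogonal_states psi ->
    locc_distinguishable (fun i => tens Phi (psi i)).

Definition universal_local_unamb (C : numClosedFieldType) (N : nat)
  (L' L : 'I_N -> finType) (Phi : vec C L') : Prop :=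
  forall (n : nat) (psi : 'I_n -> vec C L), lin_indep_states psi ->
    locc_unamb_distinguishable (fun i => tens Phi (psi i)).

(* Main.v *)
Require Import Defs.
From HB Require Import structures.
From mathcomp Require Import all_boot all_order all_algebra.
From mathcomp Require Import perm fingroup boolp reals complex ring.
Set Implicit Arguments. Unset Strict Implicit. Unset Printing Implicit Defensive.
Import Order.TTheory GRing.Theory Num.Theory.
Local Open Scope ring_scope.
Local Open Scope sesquilinear_scope.

(* An LOCC measurement element is a sum of terms M^* M with M a product operator,
   so a product functional l on the doubled system vanishes on all Phi (x) B_j
   except j = i.  Contracting l with Phi gives A Phi for a product operator A, and
   biorthogonality forces A Phi to be a multiple of the complex conjugate of B_i
   when B is an orthonormal basis.  Hence Phi is transformed by SLOCC into the
   conjugate of each B_i.  Taking B to contain the conjugates of representatives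
   of two maximal classes, Phi would lie in both.  The two representatives can be
   made orthogonal because any hyperplane of d x d matrices, d >= 2, contains an
   invertible matrix, which acts locally without leaving the SLOCC class. *)

(** Sums over global labels factor party by party through this identity. Passing to [fprod] turns
    dependent functions into tagged ones, where ordinary distributivity applies. *)
Lemma big_dffun_distr (R : comNzRingType) (I : finType) (T : I -> finType)
    (F : forall i, T i -> R) :
  \sum_(f : {dffun forall i, T i}) \prod_i F i (f i)
  = \prod_i \sum_(a : T i) F i a.
Proof.
rewrite (reindex (@dffun_of_fprod I T)); last exact/onW_bij/dffun_of_fprod_bij.
transitivity (\sum_(t : fprod T) \prod_(i in I) [ffun a => F i a] (t i)).
  by apply: eq_bigr => t _; apply: eq_bigr => i _; rewrite !ffunE.
rewrite (big_fprod 1 [the Monoid.add_law _ _ of +%R] (fun i => [ffun a => F i a])).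
transitivity (\prod_i \sum_(j in tagged_with (fun x => T x) i)
    untag 0 ([ffun a => F i a] : T i -> R) j).
  by rewrite bigA_distr_big_dep.
apply: eq_bigr => i _; rewrite -(big_tag (fun i => [ffun a => F i a] : T i -> R)).
by apply: eq_bigr => a _; rewrite ffunE.
Qed.

(** * Product operators on the tensor product space *)

Section ProductOperators.
Context (C : numClosedFieldType) (N : nat) (L : 'I_N -> finType).
Implicit Types (u v w : vec C L) (M P : op C L).

Definition scalev (a : C) v : vec C L := fun f => a * v f.
Definition conjv v : vec C L := fun f => (v f)^*.

Definition prod_op (A : forall k, L k -> L k -> C) : op C L :=
  fun f g => \prod_k A k (f k) (g k).

(** The dependent update [dfwith] places [A] at party [k] without a cast along [j = k]. *)
Definition local_family k (A : L k -> L k -> C) : forall j, L j -> L j -> C :=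
  dfwith (fun j (a b : L j) => (a == b)%:R) A.

Lemma sum_deltal (T : finType) (a : T) (F : T -> C) :
  \sum_b (a == b)%:R * F b = F a.
Proof.
rewrite (bigD1 a) //= eqxx mul1r big1 ?addr0 // => b /negPf.
by rewrite eq_sym => ->; rewrite mul0r.
Qed.

Lemma sum_deltar (T : finType) (a : T) (F : T -> C) :
  \sum_b F b * (b == a)%:R = F a.
Proof.
by rewrite -[RHS](sum_deltal a); apply: eq_bigr => b _; rewrite mulrC eq_sym.
Qed.

Lemma loc_prod_op k (A : L k -> L k -> C) : loc A = prod_op (local_family A).
Proof.
apply: funext => f; apply: funext => g.
rewrite /loc /prod_op [RHS](bigD1 k) //= mulrC /local_family dfwith_in.
by congr (_ * _); apply: eq_bigr => j jk; rewrite dfwith_out // eq_sym.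
Qed.

Lemma idop_prod_op :
  @idop C N L = prod_op (fun k a b => (a == b)%:R).
Proof.
apply: funext => f; apply: funext => g; rewrite /idop /prod_op.
have [->|neq] := eqVneq f g; first by rewrite big1 // => k _; rewrite eqxx.
have [k fgk] : exists k, f k != g k.
  apply/existsP; apply: contra_neqT neq => /existsPn fg.
  by apply/ffunP => k; apply/eqP; rewrite -[_ == _]negbK; exact: fg.
by rewrite (bigD1 k) //= (negPf fgk) mul0r.
Qed.

Lemma opv_idop v : opv (@idop C N L) v = v.
Proof. by apply: funext => f; rewrite /opv sum_deltal. Qed.

Lemma opv_opm M P v : opv (opm M P) v = opv M (opv P v).
Proof.
apply: funext => f; rewrite /opv /opm.
under eq_bigr do rewrite mulr_suml.
rewrite exchange_big; apply: eq_bigr => h _ /=; rewrite mulr_sumr.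
by apply: eq_bigr => g _; rewrite mulrA.
Qed.

Lemma opvZ M a v : opv M (scalev a v) = scalev a (opv M v).
Proof.
apply: funext => f; rewrite /opv /scalev mulr_sumr.
by apply: eq_bigr => g _; rewrite mulrCA.
Qed.

Lemma opm_prod_op (A B : forall k, L k -> L k -> C) :
  opm (prod_op A) (prod_op B)
  = prod_op (fun k a b => \sum_c A k a c * B k c b).
Proof.
apply: funext => f; apply: funext => g; rewrite /opm /prod_op.
rewrite -(big_dffun_distr (fun k c => A k (f k) c * B k c (g k))).
by apply: eq_bigr => h _; rewrite big_split.
Qed.

Lemma eq_prod_op (A B : forall k, L k -> L k -> C) :
  (forall k a b, A k a b = B k a b) -> prod_op A = prod_op B.
Proof.
move=> AB; apply: funext => f; apply: funext => g.
by apply: eq_bigr => k _; exact: AB.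
Qed.

Lemma opm_loc k (A B : L k -> L k -> C) :
  opm (loc A) (loc B) = loc (fun a b => \sum_c A a c * B c b).
Proof.
rewrite !loc_prod_op opm_prod_op; apply: eq_prod_op => j; rewrite /local_family.
case: dfwithP => [|j' kj'] a b; first by rewrite !dfwith_in.
by rewrite !dfwith_out // sum_deltal.
Qed.

Lemma loc_delta k : loc (fun a b : L k => (a == b)%:R) = @idop C N L.
Proof.
rewrite loc_prod_op idop_prod_op; apply: eq_prod_op => j.
by rewrite /local_family; case: dfwithP.
Qed.

Lemma locZ k c (A : L k -> L k -> C) :
  loc (fun a b => c * A a b) = fun f g => c * loc A f g.
Proof. by apply: funext => f; apply: funext => g; rewrite /loc mulrCA. Qed.

Lemma opv_locZ k c (A : L k -> L k -> C) v :
  opv (loc (fun a b => c * A a b)) v = scalev c (opv (loc A) v).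
Proof.
apply: funext => f; rewrite locZ /opv /scalev mulr_sumr.
by apply: eq_bigr => g _; rewrite mulrA.
Qed.

Lemma dotv_adj M u v : dotv u (opv (adj M) v) = dotv (opv M u) v.
Proof.
rewrite /dotv /opv /adj.
under eq_bigr do rewrite mulr_sumr.
rewrite exchange_big; apply: eq_bigr => g _ /=.
rewrite rmorph_sum mulr_suml; apply: eq_bigr => f _ /=.
by rewrite rmorphM mulrA [(u f)^* * _]mulrC.
Qed.

Lemma dotvv_ge0 v : 0 <= dotv v v.
Proof. by apply: sumr_ge0 => f _; rewrite mulrC mul_conjC_ge0. Qed.

Lemma dotvv_eq0 v f : dotv v v = 0 -> v f = 0.
Proof.
move/eqP; rewrite psumr_eq0 => [/allP/(_ f)|g _]; last first.
  by rewrite mulrC mul_conjC_ge0.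
by rewrite mem_index_enum mulrC mul_conjC_eq0 => /(_ isT)/eqP.
Qed.

Lemma expect_sumop n (M : 'I_n -> op C L) v :
  expect (sumop M) v = \sum_j expect (M j) v.
Proof.
rewrite /expect /dotv /opv /sumop exchange_big; apply: eq_bigr => f _ /=.
rewrite -mulr_sumr; congr (_ * _); rewrite exchange_big; apply: eq_bigr => g _ /=.
by rewrite mulr_suml.
Qed.

Lemma expect_sandwich M P v :
  expect (opm (adj M) (opm P M)) v = expect P (opv M v).
Proof. by rewrite /expect !opv_opm dotv_adj. Qed.

(** * Product functionals inside LOCC measurement elements *)

Section Protocols.
Context (O : eqType).
Implicit Type t : locc_tree C L O.

Lemma expect_povm_ge0 t o v : 0 <= expect (locc_povm t o) v.
Proof.
elim: t v => [o'|k m K ch IH] v /=.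
  case: ifP => _; first by rewrite /expect opv_idop dotvv_ge0.
  rewrite /expect /dotv big1 // => f _.
  by rewrite /opv big1 ?mulr0 // => g _; rewrite mul0r.
by rewrite expect_sumop; apply: sumr_ge0 => j _; rewrite expect_sandwich.
Qed.

(* Every POVM element of a protocol is a sum of terms M^* M with M a product
   operator; reading off one entry of M v gives the functional. *)
Lemma povm_product_functional t o (J : Type) (v : J -> vec C L) (i : J) :
  expect (locc_povm t o) (v i) != 0 ->
  (forall j, j <> i -> expect (locc_povm t o) (v j) = 0) ->
  exists a : forall k, L k -> C,
    \sum_(f : glab L) (\prod_k a k (f k)) * v i f != 0 /\
    forall j, j <> i -> \sum_(f : glab L) (\prod_k a k (f k)) * v j f = 0.
Proof.
elim: t v => [o'|k m K ch IH] v /=.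
  case: ifP => _ vi vj; last first.
    case/eqP: vi; rewrite /expect /dotv big1 // => f _.
    by rewrite /opv big1 ?mulr0 // => g _; rewrite mul0r.
  rewrite /expect opv_idop in vi.
  have [f vif] : exists f, v i f != 0.
    apply/existsP; apply: contraNT vi => /existsPn vi0.
    rewrite /dotv big1 // => f _.
    by move/negP: (vi0 f) => /negP; rewrite negbK => /eqP ->; rewrite mulr0.
  (* At a leaf the element is the identity, and reading the coordinate [f] is a product of
     deltas. *)
  exists (fun k a => (f k == a)%:R).
  have E (w : vec C L) : \sum_(g : glab L) (\prod_k (f k == g k)%:R) * w g = w f.
    by rewrite -[in RHS](opv_idop w) idop_prod_op.
  rewrite E; split=> // j /vj; rewrite /expect opv_idop => vj0.
  by rewrite E (dotvv_eq0 _ vj0).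
rewrite expect_sumop => vi vj.
have [l vil] : exists l, expect (locc_povm (ch l) o) (opv (loc (K l)) (v i)) != 0.
  apply/existsP; apply: contraNT vi => /existsPn vi0.
  rewrite big1 // => l _; rewrite expect_sandwich.
  by apply/eqP; rewrite -[_ == _]negbK; exact: vi0.
have [j ji|a [ai aj]] := IH l (fun j => opv (loc (K l)) (v j)) vil.
  (* All branch terms are nonnegative, so a vanishing sum vanishes on branch [l] too. *)
  move/eqP: (vj j ji); rewrite expect_sumop psumr_eq0; last first.
    by move=> l' _; rewrite expect_sandwich expect_povm_ge0.
  by move=> /allP/(_ l); rewrite mem_index_enum expect_sandwich => /(_ isT)/eqP.
(* The functional [a] pulled back through [K l], still a product because [loc] is a product
   operator. *)
pose b j c := \sum_c' a j c' * local_family (K l) c' c.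
have E (w : vec C L) : \sum_(f : glab L) (\prod_k a k (f k)) * opv (loc (K l)) w f
  = \sum_(f : glab L) (\prod_k b k (f k)) * w f.
  rewrite /opv; under eq_bigr do rewrite mulr_sumr.
  rewrite exchange_big; apply: eq_bigr => g _ /=.
  rewrite /b -(big_dffun_distr (fun k c' => a k c' * local_family (K l) c' (g k))).
  rewrite mulr_suml; apply: eq_bigr => h _.
  by rewrite big_split mulrA loc_prod_op.
by exists b; rewrite -E; split=> // j /aj; rewrite E.
Qed.

End Protocols.
End ProductOperators.

(** * Completing a local operator to an instrument *)

Section Twirling.
Context (C : numClosedFieldType) (T : finType).

(** When [a] and [b] differ, flipping the sign at [a] permutes the sign vectors and negates every
    term, so the sum is its own opposite. *)
Lemma sum_sign_orthogonal (a b : T) :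
  \sum_(s : {ffun T -> bool}) (-1) ^+ s a * (-1) ^+ s b
  = #|{ffun T -> bool}|%:R * (a == b)%:R :> C.
Proof.
have [->|ab] := eqVneq a b.
  under eq_bigr do rewrite -expr2 sqrr_sign.
  by rewrite sumr_const mulr1.
rewrite mulr0; set S := LHS.
pose flip (s : {ffun T -> bool}) := [ffun i => (i == a) (+) s i].
have flipK : involutive flip by move=> s; apply/ffunP => i; rewrite !ffunE addKb.
have : S = - S.
  rewrite {1}/S (reindex_inj (inv_inj flipK)) -sumrN; apply: eq_bigr => s _ /=.
  by rewrite !ffunE eqxx eq_sym (negPf ab) addTb addFb signrN mulNr.
by move/eqP; rewrite -addr_eq0 -mulr2n mulrn_eq0 => /eqP.
Qed.

(* Composing A with all signed permutations on the right makes the average of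
   the A^* A scalar, which completes a multiple of A to an instrument. *)
Lemma kraus_completion (A : T -> T -> C) (x y : T) : A x y != 0 ->
  exists (m : nat) (K : 'I_m -> T -> T -> C) (l : 'I_m) (c : C),
    [/\ c != 0,
        forall a b, \sum_(j < m) \sum_d (K j d a)^* * K j d b = (a == b)%:R
      & K l = fun a b => c * A a b].
Proof.
move=> Axy.
(* [G s] is the Gram matrix of the columns of [A] permuted by [s]. Summed over all signed
   permutations it becomes [kappa] times the identity. *)
pose G (s : {perm T}) a b := \sum_d (A d (s a))^* * A d (s b).
pose kappa := #|{ffun T -> bool}|%:R * \sum_s G s x x.
have G_ge0 s a : 0 <= G s a a.
  by apply: sumr_ge0 => d _; rewrite mulrC mul_conjC_ge0.
have kappa_gt0 : 0 < kappa.
  rewrite mulr_gt0 //.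
    by rewrite ltr0n; apply/card_gt0P; exists [ffun=> false].
  (* This transposition brings column [y] to place [x], where the entry [A x y] contributes a
     positive term. *)
  rewrite (bigD1 (tperm x y)) //= ltr_pwDl ?sumr_ge0 //.
  rewrite /G tpermL (bigD1 x) //= ltr_pwDl ?sumr_ge0 // => [|d _].
    by rewrite mulrC mul_conjC_gt0.
  by rewrite mulrC mul_conjC_ge0.
pose c := (sqrtC kappa)^-1.
have c_gt0 : 0 < c by rewrite invr_gt0 sqrtC_gt0.
have c2 : c * c * kappa = 1.
  by rewrite -expr2 exprVn sqrtCK mulVf ?gt_eqF.
pose K (i : {ffun T -> bool} * {perm T}) a b := c * ((-1) ^+ i.1 b * A a (i.2 b)).
exists #|{: {ffun T -> bool} * {perm T}}|, (fun j => K (enum_val j)).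
exists (enum_rank ([ffun=> false], 1%g)), c.
split; first by rewrite gt_eqF.
- move=> a b.
  transitivity (\sum_i \sum_d (K i d a)^* * K i d b).
    by rewrite [RHS](reindex _ (onW_bij _ (@enum_val_bij _))).
  transitivity (c * c * (\sum_(s : {ffun T -> bool}) (-1) ^+ s a * (-1) ^+ s b)
                * \sum_s G s a b).
    rewrite -mulrA big_distrlr [in RHS]pair_bigA [in RHS]mulr_sumr /=.
    apply: eq_bigr => -[s t] _ /=.
    rewrite /K /G mulr_sumr mulr_sumr; apply: eq_bigr => d _ /=.
    rewrite !rmorphM /= rmorphXn rmorphN1 /= (CrealP (gtr0_real c_gt0)).
    by ring.
  rewrite sum_sign_orthogonal; have [<-|_] := eqVneq a b; last first.
    by rewrite !mulr0 mul0r.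
  rewrite mulr1 -mulrA -[RHS]c2; congr (_ * (_ * _)).
  (* Translating the permutations shows that the diagonal entry at [a] equals the one at [x]. *)
  rewrite (reindex_inj (mulgI (tperm a x))); apply: eq_bigr => s _.
  by rewrite /G !permM tpermL.
- apply: funext => a; apply: funext => b.
  by rewrite /K enum_rankK /= ffunE perm1 expr0 mul1r.
Qed.

End Twirling.

(** * Stochastic transformations by product operators *)

Section Slocc.
Context (C : numClosedFieldType) (N : nat) (L : 'I_N -> finType).
Implicit Types (u v w : vec C L) (M : op C L).

Lemma proj_scalev (a : C) v :
  proj (scalev a v) = fun f g => a * a^* * proj v f g.
Proof.
apply: funext => f; apply: funext => g.
by rewrite /proj /scalev rmorphM mulrACA.
Qed.

Lemma proj_opv M v : opm M (opm (proj v) (adj M)) = proj (opv M v).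
Proof.
apply: funext => f; apply: funext => g; rewrite /opm /adj /proj /opv.
rewrite rmorph_sum mulr_suml; apply: eq_bigr => h _ /=.
rewrite -mulrA !mulr_sumr; apply: eq_bigr => h' _.
by rewrite rmorphM -mulrA [(v h')^* * _]mulrC.
Qed.

Lemma locc_postZ (O : eqType) (t : locc_tree C L O) o (a : C) (rho : op C L) :
  locc_post t o (fun f g => a * rho f g)
  = fun f g => a * locc_post t o rho f g.
Proof.
elim: t rho => [o'|k m K ch IH] rho /=.
  by case: ifP => // _; apply: funext => f; apply: funext => g; rewrite mulr0.
apply: funext => f; apply: funext => g; rewrite /sumop mulr_sumr.
apply: eq_bigr => j _; rewrite -[RHS](congr1 (fun M => M f g) (IH _ _)).
congr (locc_post _ _ _ _ _); apply: funext => f'; apply: funext => g'.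
rewrite /opm [in RHS]mulr_sumr; apply: eq_bigr => h _.
rewrite [in RHS]mulrCA [in RHS]mulr_sumr; congr (_ * _); apply: eq_bigr => h' _.
by rewrite mulrA.
Qed.

(** The source of [slocc_trans] may be unnormalised, so the squared modulus of [c] is absorbed into
    the factor [p]. *)
Lemma slocc_trans_scalev (c : C) v : c != 0 -> slocc_trans (scalev c v) v.
Proof.
move=> c0; exists (LLeaf C L true); split=> //; exists (c * c^*).
by rewrite mul_conjC_gt0 /= proj_scalev.
Qed.

(** A multiple of the nonzero [A] is one Kraus operator of an instrument: the protocol measures it
    first, continues with the given tree on that outcome and reports failure on all others. *)
Lemma slocc_trans_loc k (A : L k -> L k -> C) x y v w : A x y != 0 ->
  slocc_trans (opv (loc A) v) w -> slocc_trans v w.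
Proof.
move=> /kraus_completion [m [K [l [c [c0 complete Kl]]]]].
move=> [t [t_valid [p [p_gt0 post_t]]]].
exists (LNode K (fun j => if j == l then t else LLeaf C L false)); split=> /=.
  by split=> // j; case: ifP.
exists (c * c^* * p); split; first by rewrite mulr_gt0 ?mul_conjC_gt0.
apply: funext => f; apply: funext => g; rewrite /sumop (bigD1 l) //= eqxx.
rewrite big1 ?addr0 => [|j /negPf -> //].
rewrite proj_opv Kl opv_locZ proj_scalev locc_postZ post_t.
by rewrite mulrA.
Qed.

(** The factors are applied one party at a time; each is nonzero because the output has a nonzero
    coordinate. *)
Lemma slocc_trans_prod_op (A : forall k, L k -> L k -> C) (c : C) v w f :
  c != 0 -> w f != 0 -> opv (prod_op A) v = scalev c w -> slocc_trans v w.
Proof.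
move=> c0 wf Avw.
have A_neq0 k : exists x y, A k x y != 0.
  have : \sum_g prod_op A f g * v g != 0.
    by rewrite -[X in X != 0]/(opv (prod_op A) v f) Avw mulf_neq0.
  have [g Afg|A0] := pickP (fun g => prod_op A f g != 0); last first.
    by rewrite big1 ?eqxx // => g _; move/negbFE/eqP: (A0 g) => ->; rewrite mul0r.
  by move=> _; exists (f k), (g k); move/prodf_neq0: Afg; apply.
(* The factors of the parties in [s], identity elsewhere. Induction on a duplicate-free [s] peels
   off one party per step. *)
pose part (s : seq 'I_N) k a b := if k \in s then A k a b else (a == b)%:R.
have chain s u : uniq s -> slocc_trans (opv (prod_op (part s)) u) w ->
    slocc_trans u w.
  elim: s u => [|k s IH] u /=; first by rewrite -idop_prod_op opv_idop.
  move=> /andP[ks us]; have [x [y Axy]] := A_neq0 k.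
  suff -> : prod_op (part (k :: s)) = opm (prod_op (part s)) (loc (A k)).
    by rewrite opv_opm => /(IH _ us); apply: slocc_trans_loc Axy.
  rewrite loc_prod_op opm_prod_op; apply: eq_prod_op => j a b.
  rewrite /part inE /local_family; case: (eqVneq k j) => [kj|kj] /=.
    by subst j; rewrite (negPf ks) sum_deltal dfwith_in.
  by rewrite dfwith_out // sum_deltar.
apply: (chain (enum 'I_N)); first exact: enum_uniq.
suff -> : prod_op (part (enum 'I_N)) = prod_op A.
  by rewrite Avw; exact: slocc_trans_scalev.
by apply: eq_prod_op => k a b; rewrite /part mem_enum.
Qed.

End Slocc.

(** * From discrimination on the doubled system to SLOCC transformations *)

Section Discrimination.
Context (C : numClosedFieldType) (N : nat) (L : 'I_N -> finType).
Implicit Types (u v w Phi psi phi : vec C L).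

(* Viewing a functional on C^(L k) (x) C^(L k) as an operator on C^(L k) turns a
   product functional on the doubled system into a product operator. *)
Lemma sum_product_functional_tens (a : forall k, L k * L k -> C) Phi psi :
  \sum_(f : glab (pairlab L L)) (\prod_k a k (f k)) * tens Phi psi f
  = \sum_x opv (prod_op (fun k x y => a k (y, x))) Phi x * psi x.
Proof.
pose pair (y x : glab L) : glab (pairlab L L) :=
  [ffun k => (y k, x k) : pairlab L L k].
pose fst (f : glab (pairlab L L)) : glab L := [ffun k => (f k).1].
pose snd (f : glab (pairlab L L)) : glab L := [ffun k => (f k).2].
have fstK y x : fst (pair y x) = y by apply/ffunP => k; rewrite !ffunE.
have sndK y x : snd (pair y x) = x by apply/ffunP => k; rewrite !ffunE.
have pair_bij : bijective (fun p => pair p.1 p.2).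
  exists (fun f => (fst f, snd f)) => [[x y]|f]; first by rewrite fstK sndK.
  by apply/ffunP => k; rewrite !ffunE /=; case: (f k).
rewrite (reindex _ (onW_bij _ pair_bij)) /=.
rewrite -(pair_bigA _ (fun y x => (\prod_k a k (pair y x k))
  * tens Phi psi (pair y x))) /=.
rewrite exchange_big; apply: eq_bigr => x _ /=; rewrite /opv mulr_suml.
apply: eq_bigr => y _; rewrite /tens -/(fst _) -/(snd _) fstK sndK mulrA.
by congr (_ * _ * _); apply: eq_bigr => k _; rewrite ffunE.
Qed.

Lemma dotv_orthonormal_sum (n : nat) (B : 'I_n -> vec C L) (c : 'I_n -> C) j :
  mutually_orthogonal_states B ->
  dotv (B j) (fun f => \sum_i c i * B i f) = c j.
Proof.
move=> [B_state B_orth]; rewrite /dotv; under eq_bigr do rewrite mulr_sumr.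
rewrite exchange_big (bigD1 j) //= [X in _ + X]big1 ?addr0 => [|l lj].
  rewrite -[RHS]mulr1 -(B_state j) /dotv mulr_sumr.
  by apply: eq_bigr => x _; rewrite mulrCA.
transitivity (c l * dotv (B j) (B l)); last by rewrite B_orth ?mulr0 // eq_sym.
by rewrite /dotv mulr_sumr; apply: eq_bigr => x _; rewrite mulrCA.
Qed.

(** Makes the basis built below an admissible input for unambiguous discrimination too. *)
Lemma orthonormal_lin_indep (n : nat) (B : 'I_n -> vec C L) :
  mutually_orthogonal_states B -> lin_indep_states B.
Proof.
move=> B_orth; split=> [i|c c0 i]; first exact: B_orth.1.
rewrite -(dotv_orthonormal_sum c i B_orth) /dotv big1 // => f _.
by rewrite c0 mulr0.
Qed.

Lemma dotv_conjv u v : dotv (conjv u) (conjv v) = (dotv u v)^*.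
Proof. by rewrite /dotv rmorph_sum; apply: eq_bigr => f _; rewrite rmorphM. Qed.

Lemma povm_slocc_trans (O : eqType) (t : locc_tree C (pairlab L L) O) (o : O)
    (n : nat) (B : 'I_n -> vec C L) (i : 'I_n) Phi phi :
  orthonormal_basis B -> B i = conjv phi ->
  expect (locc_povm t o) (tens Phi (B i)) != 0 ->
  (forall j, j <> i -> expect (locc_povm t o) (tens Phi (B j)) = 0) ->
  slocc_trans Phi phi.
Proof.
move=> [B_orth B_span] Bi exp_i exp_j.
have [a [ai aj]] := povm_product_functional (v := fun j => tens Phi (B j)) exp_i exp_j.
pose A k x y := a k (y, x); pose w := opv (prod_op A) Phi.
have {}ai : \sum_x w x * B i x != 0 by rewrite -sum_product_functional_tens.
have {}aj j : j <> i -> \sum_x w x * B j x = 0.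
  by rewrite -sum_product_functional_tens; apply: aj.
(* The pairing of [w] with [B j] is bilinear, so it is [conjv w] whose coefficients in the basis are
   the conjugated pairings. *)
have [c cE] := B_span (conjv w).
have dotB j : dotv (B j) (conjv w) = c j.
  by rewrite -(dotv_orthonormal_sum c j B_orth) (funext cE).
have cj j : j <> i -> c j = 0.
  move=> /aj aj0; rewrite -dotB -[RHS]conjC0 -aj0 rmorph_sum /dotv.
  by apply: eq_bigr => x _; rewrite rmorphM mulrC.
have wE : w = scalev (c i)^* phi.
  apply: funext => x; rewrite -[LHS]conjCK -[(w x)^*]/(conjv w x) cE.
  rewrite (bigD1 i) //= big1 ?addr0 => [|j /eqP/cj -> //]; last by rewrite mul0r.
  by rewrite Bi rmorphM /= /conjv conjCK.
have ci : c i != 0.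
  apply: contraNneq ai => ci0; rewrite big1 // => x _.
  by rewrite wE ci0 /scalev conjC0 !mul0r.
have [f phif] : exists f, phi f != 0.
  apply/existsP; apply: contraNT ai => /existsPn phi0.
  rewrite big1 // => x _; move/negbNE/eqP: (phi0 x) => phix.
  by rewrite wE /scalev phix mulr0 mul0r.
by apply: (slocc_trans_prod_op (c := (c i)^*) _ phif wE); rewrite conjC_eq0.
Qed.

(** The two vectors are the rows of [V]; an orthonormal basis of their orthogonal complement is
    stacked below. *)
Lemma orthonormal_pair_extension u v :
  is_state u -> is_state v -> dotv u v = 0 ->
  exists (n : nat) (B : 'I_n -> vec C L) (i j : 'I_n),
    [/\ orthonormal_basis B, B i = u & B j = v].
Proof.
move=> u_state v_state uv0.
have vu0 : dotv v u = 0.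
  rewrite -[RHS]conjC0 -uv0 /dotv rmorph_sum; apply: eq_bigr => f _.
  by rewrite rmorphM /= conjCK mulrC.
pose n := #|glab L|.
pose V : 'M[C]_(2, n) := \matrix_(i, x) (if i == 0 then u else v) (enum_val x).
have V_unitary : V \is unitarymx.
  have E w1 w2 : \sum_(x < n) w1 (enum_val x) * (w2 (enum_val x))^* = dotv w2 w1.
    rewrite /dotv [RHS](reindex _ (onW_bij _ (@enum_val_bij _))).
    by apply: eq_bigr => x _; rewrite mulrC.
  apply/unitarymxP/matrixP => i j; rewrite !mxE.
  under eq_bigr do rewrite !mxE.
  rewrite E; case: (unliftP 0 i) => [i' ->|->]; case: (unliftP 0 j) => [j' ->|->];
    by rewrite /= ?(ord1 i') ?(ord1 j').
(* Rows in the kernel of the adjoint of [V] are those orthogonal to [u] and [v]. A free row base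
   makes Gram-Schmidt preserve their span. *)
pose K := schmidt (row_base (kermx (V ^t*))).
have KV : K *m V ^t* = 0.
  by apply/sub_kermxP; rewrite eqmx_schmidt_free ?eq_row_base ?row_base_free.
pose W := col_mx V K.
have W_unitary : W \is unitarymx.
  apply/unitarymxP; rewrite tr_col_mx map_row_mx mul_col_row KV.
  rewrite !(unitarymxP _) ?schmidt_unitarymx ?rank_leq_col //.
  suff -> : V *m K ^t* = 0 by rewrite -scalar_mx_block.
  by have /(congr1 (fun M => M ^t*)) := KV; rewrite trmx_mul map_mxM trmxCK trmx0 map_mx0.
(* Rank count: 2 rows from [V] and [n - 2] from the kernel. *)
have W_full : row_full W.
  rewrite /row_full mxrank_unitary // mxrank_ker mxrank_map mxrank_tr.
  by rewrite mxrank_unitary // subnKC // -(mxrank_unitary V_unitary) rank_leq_col.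
pose B i : vec C L := fun f => W i (enum_rank f).
have dotB i j : dotv (B i) (B j) = (j == i)%:R.
  have /unitarymxP/matrixP/(_ j i) := W_unitary; rewrite !mxE => <-.
  rewrite /dotv (reindex _ (onW_bij _ (@enum_val_bij _))).
  by apply: eq_bigr => x _; rewrite /B enum_valK !mxE mulrC.
exists _, B, (lshift _ 0), (lshift _ 1); split; last 2 first.
- by apply: funext => f; rewrite /B col_mxEu mxE enum_rankK.
- by apply: funext => f; rewrite /B col_mxEu mxE enum_rankK.
split; first by split=> [i|i j /negPf]; rewrite /is_state dotB ?eqxx // eq_sym => ->.
move=> w; have /submxP[D wD] := submx_full (\row_x w (enum_val x)) W_full.
exists (fun i => D 0 i) => f; move/rowP/(_ (enum_rank f)): wD.
by rewrite !mxE enum_rankK.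
Qed.

End Discrimination.

(** * Orthogonal representatives within an SLOCC class *)

Section Orthogonalization.
Context (C : numClosedFieldType).

(** Write X = V D U with U, V invertible and D diagonal, and take A = U^-1 P V^-1 with P the cyclic
    shift. Then tr(A X) = tr(P D) = 0, as the shift has no fixed point. *)
Lemma exists_unitmx_mxtrace_mul0 n (X : 'M[C]_n) : (2 <= n)%N ->
  exists2 A : 'M[C]_n, A \in unitmx & \tr (A *m X) = 0.
Proof.
move=> n2; pose s : 'S_n := perm (@ordS_inj n).
have := (mulmx_ebase X, row_ebase_unit X, col_ebase_unit X).
move: (row_ebase X) (col_ebase X) (\rank X) => U V r [[<- U_unit] V_unit].
exists (invmx U *m perm_mx s *m invmx V).
  by rewrite !unitmx_mul !unitmx_inv U_unit V_unit unitmx_perm.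
rewrite !mulmxA mulmxKV // mxtrace_mulC !mulmxA mulmxV // mul1mx -row_permE.
rewrite /mxtrace big1 // => i _; rewrite !mxE permE.
suff /negPf -> : ordS i != i :> nat by [].
rewrite /=; have [lt_in|] := ltnP i.+1 n; first by rewrite modn_small // gtn_eqF.
(* The last index wraps round to 0, which differs from it since [n >= 2]. *)
rewrite leq_eqVlt ltnNge ltn_ord orbF => /eqP i_n.
by rewrite -i_n modnn ltn_eqF // -ltnS -i_n.
Qed.

Context (N : nat) (d : 'I_N -> nat).
Implicit Types u v : vec C (Hlab d).

(** The inner product is linear in [A], hence of the form tr(A X), with X read off on the matrix
    units [E a b]. The inverse [B] serves to undo [A]. *)
Lemma exists_orthogonal_local k u v : (2 <= d k)%N ->
  exists A B : 'I_(d k) -> 'I_(d k) -> C,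
    (forall a b, \sum_c B a c * A c b = (a == b)%:R) /\
    dotv u (opv (@loc _ _ (Hlab d) k A) v) = 0.
Proof.
move=> dk.
pose E a b : op C (Hlab d) :=
  @loc _ _ (Hlab d) k (fun a' b' => ((a' == a) && (b' == b))%:R).
pose X : 'M[C]_(d k) := \matrix_(b, a) dotv u (opv (E a b) v).
have [A A_unit trAX] := exists_unitmx_mxtrace_mul0 X dk.
exists A, (invmx A); split=> [a b|].
  by have /matrixP/(_ a b) := mulVmx A_unit; rewrite !mxE.
rewrite -{}trAX /mxtrace.
have locA f g : @loc _ _ (Hlab d) k A f g = \sum_a \sum_b A a b * E a b f g.
  rewrite (bigD1 (f k)) //= (bigD1 (g k)) //= /E /loc !eqxx mulr1 mulrC.
  rewrite [X in _ + X + _]big1 => [|b bg]; last first.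
    by rewrite [_ == b]eq_sym (negPf bg) andbF !mulr0.
  rewrite [X in _ + X]big1 ?addr0 // => a af; rewrite big1 // => b _.
  by rewrite [_ == a]eq_sym (negPf af) !mulr0.
transitivity (\sum_a \sum_b A a b * dotv u (opv (E a b) v)); last first.
  by apply: eq_bigr => a _; rewrite mxE; apply: eq_bigr => b _; rewrite mxE.
rewrite /dotv.
under [RHS]eq_bigr do (under eq_bigr do rewrite mulr_sumr; rewrite exchange_big).
rewrite exchange_big; apply: eq_bigr => f _ /=.
under [RHS]eq_bigr do (under eq_bigr do rewrite mulrCA; rewrite -mulr_sumr).
rewrite -mulr_sumr; congr (_ * _); rewrite /opv.
under [RHS]eq_bigr do (under eq_bigr do rewrite mulr_sumr; rewrite exchange_big).
rewrite exchange_big; apply: eq_bigr => g _ /=.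
rewrite locA mulr_suml; apply: eq_bigr => a _; rewrite mulr_suml.
by apply: eq_bigr => b _; rewrite -mulrA.
Qed.

(** The new state is the normalised image of [v] under an invertible local operator, whose inverse
    leads back. *)
Lemma exists_orthogonal_slocc_equiv k u v : (2 <= d k)%N -> is_state v ->
  exists v', [/\ is_state v', dotv u v' = 0 & slocc_equiv v v'].
Proof.
move=> dk v_state.
have [A [B [BA uAv]]] := exists_orthogonal_local u v dk.
pose x : 'I_(d k) := Ordinal (ltnW dk).
(* A diagonal entry of [B A] is 1, which yields a nonzero entry of both [A] and [B]. *)
have [y] : exists y, B x y * A y x != 0.
  apply/existsP; apply: contra_eqT (BA x x) => /existsPn BA0.
  rewrite big1 ?eqxx 1?eq_sym ?oner_neq0 // => y _.
  by move/negbNE/eqP: (BA0 y).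
rewrite mulf_eq0 negb_or => /andP[Bxy Ayx].
pose w := opv (@loc _ _ (Hlab d) k A) v.
have Bw : opv (@loc _ _ (Hlab d) k B) w = v.
  rewrite -opv_opm opm_loc -[RHS]opv_idop -(@loc_delta _ _ _ k).
  by congr (opv (loc _) v); apply: funext => a; apply: funext => b; exact: BA.
have ww_neq0 : dotv w w != 0.
  apply: contra_eq_neq v_state => ww0; rewrite /is_state -Bw.
  suff -> : opv (@loc _ _ (Hlab d) k B) w = fun=> 0.
    by rewrite /dotv big1 1?eq_sym ?oner_neq0 // => f _; rewrite mulr0.
  apply: funext => f; rewrite /opv big1 // => g _.
  by rewrite (dotvv_eq0 g ww0) mulr0.
pose c := (sqrtC (dotv w w))^-1.
have c0 : c != 0 by rewrite invr_eq0 sqrtC_eq0.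
have c_real : c^* = c.
  by rewrite (CrealP _) // ger0_real // invr_ge0 sqrtC_ge0 dotvv_ge0.
exists (scalev c w); split.
- rewrite /is_state /dotv /scalev.
  transitivity (c ^+ 2 * dotv w w); last by rewrite exprVn sqrtCK mulVf.
  rewrite /dotv mulr_sumr; apply: eq_bigr => f _.
  by rewrite rmorphM /= c_real mulrACA.
- transitivity (c * dotv u w); last by rewrite uAv mulr0.
  by rewrite /dotv mulr_sumr; apply: eq_bigr => f _; rewrite mulrCA.
- split.
    apply: (slocc_trans_loc Ayx); rewrite -/w.
    have wE : scalev c^-1 (scalev c w) = w.
      by apply: funext => f; rewrite /scalev mulKf.
    have : slocc_trans (scalev c^-1 (scalev c w)) (scalev c w).
      by apply: slocc_trans_scalev; rewrite invr_neq0.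
    by rewrite wE.
  apply: (slocc_trans_loc Bxy); rewrite opvZ Bw.
  exact: slocc_trans_scalev.
Qed.

End Orthogonalization.

(** Only the vanishing pattern of the expectations is excluded, and [o] selects outcomes in any
    type; perfect and unambiguous discrimination are both instances. *)
Lemma exists_indistinguishable_basis (C : numClosedFieldType) (N : nat)
    (d : 'I_N -> nat) (k : 'I_N) : (2 <= d k)%N ->
  more_than_one_maximal_class C (Hlab d) ->
  exists (n : nat) (B : 'I_n -> vec C (Hlab d)),
    orthonormal_basis B /\
    forall Phi, is_state Phi ->
    forall (O : eqType) (t : locc_tree C (pairlab (Hlab d) (Hlab d)) O)
      (o : 'I_n -> O),
    ~ forall i j, (expect (locc_povm t (o i)) (tens Phi (B j)) != 0) = (i == j).
Proof.
move=> dk [phi1 [phi2 [state1 [state2 [max1 [max2 not_equiv]]]]]].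
have [phi2' [state2' orth [to_phi2' from_phi2']]] :=
  exists_orthogonal_slocc_equiv phi1 dk state2.
have conj_state (v : vec C (Hlab d)) : is_state v -> is_state (conjv v).
  by rewrite /is_state dotv_conjv => ->; rewrite conjC1.
have [|n [B [i1 [i2 [B_basis B1 B2]]]]] :=
  orthonormal_pair_extension (conj_state _ state1) (conj_state _ state2').
  by rewrite dotv_conjv orth conjC0.
exists n, B; split=> // Phi state_Phi O t o expE.
have to_phi i phi : B i = conjv phi -> slocc_trans Phi phi.
  move=> Bi; apply: (povm_slocc_trans (t := t) (o := o i) B_basis Bi).
    by rewrite expE eqxx.
  move=> j ji; apply/eqP/negbNE; rewrite expE; apply/eqP => ij; exact: ji.
have [Phi_to_1 one_to_Phi] : slocc_equiv Phi phi1.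
  have refl1 : slocc_equiv phi1 phi1.
    suff : slocc_trans phi1 phi1 by split.
    exists (LLeaf C (Hlab d) true); split=> //; exists 1; split=> //=.
    by apply: funext => f; apply: funext => g; rewrite mul1r.
  by apply: max1 (to_phi _ _ B1).
(* Maximality quantifies over targets in the whole class, so reaching [phi2'] suffices. *)
have [Phi_to_2 two_to_Phi] : slocc_equiv Phi phi2.
  by apply: max2 (to_phi _ _ B2) => //; split.
(* Maximality of [phi1] with target [Phi] stands in for transitivity. *)
have [two_to_1 one_to_2] : slocc_equiv phi2 phi1.
  by apply: max1 two_to_Phi => //; split.
by apply: not_equiv; split.
Qed.

Theorem theorem2 (R : realType) (N : nat) (d : 'I_N -> nat) :
  (3 <= N)%N -> (forall k, (2 <= d k)%N) ->
  @more_than_one_maximal_class R[i] N (Hlab d) ->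
  (~ exists Phi : vec R[i] (Hlab d),
       is_state Phi /\ universal_local_discr (Hlab d) Phi) /\
  (~ exists Phi : vec R[i] (Hlab d),
       is_state Phi /\ universal_local_unamb (Hlab d) Phi) /\
  (exists (n : nat) (B : 'I_n -> vec R[i] (Hlab d)),
     orthonormal_basis B /\
     forall Phi : vec R[i] (Hlab d), is_state Phi ->
       ~ locc_distinguishable (fun j => tens Phi (B j))).
Proof.
move=> N3 d2 classes.
have [n [B [B_basis indist]]] :=
  exists_indistinguishable_basis (d2 (Ordinal (ltnW (ltnW N3)))) classes.
have B_indist (Phi : vec R[i] (Hlab d)) : is_state Phi ->
    ~ locc_distinguishable (fun j => tens Phi (B j)).
  move=> state_Phi [Pi [[t [_ PiE]] expPi]].
  apply: (indist _ state_Phi _ t id) => i j.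
  by rewrite -PiE expPi pnatr_eq0 eqb0 negbK.
split; first by move=> [Phi [state_Phi univ]]; apply/B_indist/univ/B_basis.1.
split; last by exists n, B.
move=> [Phi [state_Phi univ]].
have [Pi [eps [[t [_ PiE]] [eps_gt0 expPi]]]] :=
  univ _ _ (orthonormal_lin_indep B_basis.1).
(* [widen_ord] picks the conclusive outcomes, leaving out the last one. *)
apply: (indist _ state_Phi _ t (widen_ord (leqnSn n))) => i j.
by rewrite -PiE expPi; have [_|_] := eqVneq i j; rewrite ?eqxx ?gt_eqF.
Qed.
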